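(* Let $X$ be a finite list of vectors in $\Lambda=\mathbb{Z}^n$ spanning $\mathbb{R}^n$, and let $\mathcal{Z}(X)=\{\sum_{x\in X}t_x x : 0\le t_x\le 1\}$ be its zonotope. For every positive integer $q$, let $\mathcal{E}_X(q)=|q\mathcal{Z}(X)\cap\Lambda|$ be the number of lattice points in the dilation $q\mathcal{Z}(X)$. Then for every positive integer $q$, $$\mathcal{E}_X(q)=q^n\, M_X(1+1/q,\,1).$$
   Context: For a sublist $A\subseteq X$, $r(A)$ denotes the dimension of the real span $\langle A\rangle_{\mathbb{R}}$, $\langle A\rangle_{\mathbb{Z}}$ denotes the sublattice of $\Lambda$ generated by $A$, $\Lambda_A=\Lambda\cap\langle A\rangle_{\mathbb{R}}$, and $m(A)=[\Lambda_A:\langle A\rangle_{\mathbb{Z}}]$. The multiplicity Tutte polynomial of $X$ is $$M_X(x,y)=\sum_{A\subseteq X} m(A)\,(x-1)^{n-r(A)}(y-1)^{|A|-r(A)},$$ the sum being over all sublists $A$ of $X$. *)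

(* Defs.v *)
From HB Require Import structures.
From mathcomp Require Import all_boot all_order all_algebra.
From mathcomp Require Import finmap.
From mathcomp Require Import boolp classical_sets functions cardinality reals.

Set Implicit Arguments.
Unset Strict Implicit.
Unset Printing Implicit Defensive.

Import Order.TTheory GRing.Theory Num.Theory.

Local Open Scope classical_set_scope.
Local Open Scope ring_scope.

(* Number of elements of a set. [fset_set] sends an infinite set to the empty
   one, so infinite sets get 0; the lattice-point sets and coset sets below
   are always finite and nonempty. *)
Definition ncard (T : choiceType) (S : set T) : nat := #|` fset_set S|.

(* [H : K], the number of cosets v + K with v in H. *)
Definition group_index (V : zmodType) (H K : set V) : nat :=
  ncard [set [set v + k | k in K] | v in H].

Section MultiplicityTutte.
Context (R : realType) (n : nat).

Definition toR (v : 'rV[int]_n) : 'rV[R]_n := map_mx intr v.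

Definition real_span (A : seq 'rV[int]_n) : {vspace 'rV[R]_n} :=
  <<map toR A>>%VS.

Definition int_span (A : seq 'rV[int]_n) : set 'rV[int]_n :=
  [set v | inIntSpan (in_tuple A) v].

Definition rk (A : seq 'rV[int]_n) : nat := \dim (real_span A).

Definition saturation (A : seq 'rV[int]_n) : set 'rV[int]_n :=
  [set v | toR v \in real_span A].

Definition multiplicity (A : seq 'rV[int]_n) : nat :=
  group_index (saturation A) (int_span A).

(* Sublists are selected by position, through bit masks, so that repeated
   vectors of [X] are distinguished. The truncated subtractions are exact
   since rk A <= n and rk A <= size A. *)
Definition mult_tutte (X : seq 'rV[int]_n) : {poly {poly R}} :=
  \sum_(b : (size X).-tuple bool)
    let A := mask b X in
    (multiplicity A)%:R * ('X - 1) ^+ (n - rk A) * ('Y - 1) ^+ (size A - rk A).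

Definition zonotope (X : seq 'rV[int]_n) : set 'rV[R]_n :=
  [set z | exists t : 'I_(size X) -> R,
     (forall i, 0 <= t i <= 1) /\ z = \sum_(i < size X) t i *: toR X`_i].

Definition dilate (c : R) (P : set 'rV[R]_n) : set 'rV[R]_n :=
  [set c *: z | z in P].

Definition lattice_count (P : set 'rV[R]_n) : nat := ncard [set v | P (toR v)].

Definition ehrhart (X : seq 'rV[int]_n) (q : nat) : nat :=
  lattice_count (dilate q%:R (zonotope X)).

End MultiplicityTutte.

(* Main.v *)
Require Import Defs.
From mathcomp Require Import all_boot all_order all_algebra finmap.
From mathcomp Require Import boolp classical_sets cardinality reals.
From mathcomp Require Import ring lra.

(* At [y = 1] only the linearly independent sublists [A] of [X] contribute, so the
   claim is that [q Z(X)] contains [sum_A m(A) q^|A|] lattice points, which is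
   proved by induction on [X] for all dimensions at once. Let [x = g e] with [e]
   primitive, and let [pi] be the projection of the lattice along [e]. Appending
   [x] to [X] lengthens every nonempty section of [q Z(X)] by a line parallel to
   [x] by [q g] lattice steps, so the number of lattice points grows by [q g]
   times that of [q Z(pi X)]. On the other side, [x :: A] is independent iff
   [pi A] is, and then [m(x :: A) = g m(pi A)]. *)

Set Implicit Arguments.
Unset Strict Implicit.
Unset Printing Implicit Defensive.

Import Order.TTheory GRing.Theory Num.Theory.

Local Open Scope ring_scope.

(** * Counting by explicit enumeration, and up-sets of the integers *)

(** [ncard] sends infinite sets to 0, so the induction carries an enumeration, which gives
    finiteness together with the count. *)
Definition has_size (T : eqType) (P : T -> Prop) (N : nat) : Prop :=
  exists s : seq T, [/\ uniq s, size s = N & forall v, v \in s <-> P v].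

Lemma eq_has_size (T : eqType) (P Q : T -> Prop) N :
  (forall v, P v <-> Q v) -> has_size P N -> has_size Q N.
Proof. by move=> eqPQ [s [us ss sP]]; exists s; split=> // v; rewrite sP. Qed.

Lemma has_size_ncard (T : choiceType) (S : set T) N : has_size S N -> ncard S = N.
Proof.
move=> [s [us <- sP]]; have -> : S = [set` [fset v in s]%fset]%classic.
  by apply/seteqP; split=> v /=; rewrite !inE sP.
by rewrite /ncard set_fsetK card_fseq undup_id.
Qed.

(** A nonempty proper up-set of the integers is a half line, and removing its translate by [N]
    leaves exactly its first [N] elements. *)
Lemma upset_diff (U : int -> Prop) (N : nat) :
  (forall a b, a <= b -> U a -> U b) -> (exists a, U a) -> (exists b, ~ U b) ->
  exists j0 : int, forall j,
    (U j /\ ~ U (j - N%:Z)) <-> exists2 i, (i < N)%N & j = j0 + i%:Z.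
Proof.
move=> upU [a Ua] [b nUb].
have ltba : b < a by rewrite ltNge; apply/negP => /upU /(_ Ua).
(* Since [b] lies outside [U], the least element of [U] can be sought among the [b + k] with [k]
   natural. *)
have exk : exists k : nat, `[< U (b + k%:Z) >].
  exists `|(a - b)%R|%N; apply/asboolP; rewrite gez0_abs ?subr_ge0 1?ltW //.
  by rewrite subrKC.
case: (ex_minnP exk) => k0 /asboolP Uk0 mink0.
have UE j : U j <-> b + k0%:Z <= j.
  split=> [Uj|/upU]; last exact.
  have ltbj : b < j by rewrite ltNge; apply/negP => /upU /(_ Uj).
  have jE : j = b + `|(j - b)%R|%N%:Z.
    by rewrite gez0_abs ?subr_ge0 1?ltW // subrKC.
  rewrite jE lerD2l lez_nat; apply: mink0; apply/asboolP; by rewrite -jE.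
exists (b + k0%:Z) => j; rewrite !UE; split=> [[le1 /negP]|[i ltiN ->]].
  rewrite -ltNge => lt2; exists `|(j - (b + k0%:Z))%R|%N; last first.
    by rewrite gez0_abs ?subr_ge0 // subrKC.
  by rewrite -ltz_nat gez0_abs ?subr_ge0 // ltrBlDl -ltrBlDr.
split; first by rewrite lerDl.
by apply/negP; rewrite -ltNge ltrBlDr ltrD2l ltz_nat.
Qed.

(** * Splitting the lattice along a primitive vector *)

(* [v |-> (v *m M, v *m f)] is an isomorphism onto the pairs, with inverse
   [(w, k) |-> w *m S + k *m e]. *)
Definition splitting (K : pzRingType) n m (e : 'rV[K]_n) (f : 'cV[K]_n)
    (S : 'M[K]_(m, n)) (M : 'M[K]_(n, m)) :=
  [/\ e *m f = 1%:M, e *m M = 0, S *m M = 1%:M & M *m S + f *m e = 1%:M].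

(** The Smith form of the one-row matrix [x] makes it a multiple of the first row of a unimodular
    [P]. That row is [e] up to sign, the other rows form [S], and the columns of the inverse of [P]
    give [f] and [M]. *)
Lemma primitive_splitting n (x : 'rV[int]_n) : x != 0 ->
  exists m e f (S : 'M[int]_(m, n)) M (g : nat),
    [/\ (0 < g)%N, x = e *+ g & splitting e f S M].
Proof.
case: n x => [x|n]; first by rewrite thinmx0 eqxx.
rewrite -[n.+1]/(1 + n)%N => x nzx.
have [L _ [P Pu [d _ xE]]] := int_Smith_normal_form x.
pose c := L 0 0 * d`_0.
have {}xE : x = c *: usubmx P.
  rewrite xE {1}[L]mx11_scalar mul_scalar_mx -scalemxAl -scalerA.
  congr (_ *: _); apply/rowP => j; rewrite !mxE (bigD1 0) //= big1 => [|i nzi].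
    by rewrite !mxE /= mulr1n addr0; congr (_ * P _ _); apply/val_inj.
  by rewrite !mxE eq_sym; move: nzi; rewrite -val_eqE => /negPf /= ->; rewrite mul0r.
have nzc : c != 0 by apply: contraNneq nzx => c0; rewrite xE c0 scale0r.
have := mulmxV Pu; have := mulVmx Pu.
move: (invmx P) => Q.
rewrite -{1 2}[P]vsubmxK -[Q]hsubmxK mul_row_col mul_col_row.
rewrite [1%:M in X in _ -> X -> _]scalar_mx_block.
move: (usubmx P) (dsubmx P) (lsubmx Q) (rsubmx Q) xE => e S f M xE eq1.
move=> /eq_block_mx [ef eM Sf SM].
(* The sign of [c] goes into both [e] and [f]: this makes [g] a natural number and keeps
   [e *m f = 1%:M]. *)
have sgsg : Num.sg c * Num.sg c = 1 by rewrite -expr2 sqr_sg nzc.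
exists n, (Num.sg c *: e), (Num.sg c *: f), S, M, `|c|%N; split.
- by rewrite absz_gt0.
- by rewrite -scaler_nat scalerA natz abszE mulrC -numEsg.
split=> //; rewrite -?scalemxAl ?eM ?scaler0 // -?scalemxAr ?scalerA ?sgsg ?scale1r //.
by rewrite addrC.
Qed.

Lemma splittingE (K : comPzRingType) n m (e : 'rV[K]_n) f (S : 'M[K]_(m, n)) M :
  splitting e f S M ->
  forall v : 'rV[K]_n, v = v *m M *m S + (v *m f) 0 0 *: e.
Proof.
move=> [_ _ _ eq1] v.
by rewrite -mul_scalar_mx -mx11_scalar -!mulmxA -mulmxDr eq1 mulmx1.
Qed.

Lemma splitting_map (K : pzRingType) n m (e : 'rV[int]_n) f (S : 'M[int]_(m, n)) M :
  splitting e f S M ->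
  splitting (map_mx intr e) (map_mx intr f) (map_mx intr S) (map_mx (intr : int -> K) M).
Proof.
move=> [ef eM SM eq1]; split; rewrite -?map_mxM ?ef ?eM ?SM ?map_mx1 //.
  by rewrite map_mx0.
by rewrite -map_mxD eq1 map_mx1.
Qed.

(** * Subgroup indices by systems of representatives *)

(** Representatives replace the set of cosets: they can be lifted through a projection, and
    finiteness of the index comes with them. *)
Definition is_index (V : zmodType) (H K : V -> Prop) (N : nat) : Prop :=
  exists s : seq V, [/\ uniq s, size s = N, forall v, v \in s -> H v,
    forall v, H v -> exists2 w, w \in s & K (v - w) &
    forall v w, v \in s -> w \in s -> K (v - w) -> v = w].

Lemma is_index_group_index (V : zmodType) (H K : set V) N :
  K 0 -> (forall u v, K u -> K v -> K (u - v)) ->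
  is_index H K N -> group_index H K = N.
Proof.
move=> K0 KB [s [us ss sH Hs sK]].
pose coset v := [set v + k | k in K]%classic.
have cosetE v w : K (v - w) -> coset v = coset w.
  move=> Kvw; have Kwv : K (w - v) by rewrite -opprB -[- _]add0r; exact: KB.
  apply/seteqP; split=> _ [k Kk <-].
    exists (k - (w - v)); first exact: KB.
    by rewrite opprB addrCA subrKC addrC.
  exists (k - (v - w)); first exact: KB.
  by rewrite opprB addrCA subrKC addrC.
have Kcoset v w : coset v = coset w -> K (v - w).
  move=> eqvw; have : coset v v by exists 0; rewrite ?addr0.
  by rewrite eqvw => -[k Kk <-]; rewrite addrC addKr.
apply: has_size_ncard; exists (map coset s); split.
- rewrite map_inj_in_uniq // => v w vs ws /Kcoset; exact: sK.
- by rewrite size_map.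
move=> C; split=> [/mapP[v /sH Hv ->]|[v /Hs [w ws /cosetE vw] <-]]; first by exists v.
by rewrite -/(coset v) vw map_f.
Qed.

(** * Integer spans *)

Lemma int_span_nil n v : int_span (n := n) [::] v <-> v = 0.
Proof.
split=> [[a ->]|->]; first by rewrite big_ord0.
by exists [ffun=> 0]; rewrite big_ord0.
Qed.

(** Trades the coefficient functions of [inIntSpan] for recursion on the list. *)
Lemma int_span_cons n (y : 'rV[int]_n) A v :
  int_span (y :: A) v <-> exists k u, int_span A u /\ v = k *: y + u.
Proof.
split=> [[a ->]|[k [_ [[a ->] ->]]]].
  exists (a ord0), (\sum_(i < size A) A`_i *~ a (lift ord0 i)); split.
    exists [ffun i => a (lift ord0 i)].
    by apply: eq_bigr => i _; rewrite ffunE.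
  by rewrite big_ord_recl /= -scaler_int intz.
exists [ffun i => if unlift ord0 i is Some j then a j else k].
rewrite big_ord_recl ffunE unlift_none /= -scaler_int intz; congr (_ + _).
by apply: eq_bigr => i _; rewrite ffunE liftK.
Qed.

Lemma int_span0 n A : int_span (n := n) A 0.
Proof.
elim: A => [|y A IH]; first exact/int_span_nil.
by apply/int_span_cons; exists 0, 0; rewrite scale0r addr0.
Qed.

Lemma int_spanB n A u v :
  int_span (n := n) A u -> int_span A v -> int_span A (u - v).
Proof.
elim: A u v => [|y A IH] u v.
  by move=> /int_span_nil -> /int_span_nil ->; rewrite subr0; apply/int_span_nil.
move=> /int_span_cons [k [u' [Au ->]]] /int_span_cons [l [v' [Av ->]]].
apply/int_span_cons; exists (k - l), (u' - v'); split; first exact: IH.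
by rewrite scalerBl opprD addrACA.
Qed.

Lemma int_span_map n m (M : 'M[int]_(n, m)) A w :
  int_span (map (mulmx^~ M) A) w <-> exists2 u, int_span A u & w = u *m M.
Proof.
elim: A w => [|y A IH] w /=.
  split=> [/int_span_nil ->|[u /int_span_nil -> ->]].
    by exists 0; rewrite ?mul0mx //; exact/int_span_nil.
  by rewrite mul0mx; apply/int_span_nil.
split=> [/int_span_cons [k [_ [/IH [u Au ->] ->]]]|[_ /int_span_cons [k [u [Au ->]]] ->]].
  exists (k *: y + u); first by apply/int_span_cons; exists k, u.
  by rewrite mulmxDl scalemxAl.
apply/int_span_cons; exists k, (u *m M); split; first by apply/IH; exists u.
by rewrite mulmxDl scalemxAl.
Qed.

(** * Sums over sublists *)

Definition sum_sublists (T : Type) (F : seq T -> nat) (X : seq T) : nat :=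
  (\sum_(b : (size X).-tuple bool) F (mask b X))%N.

Lemma sum_sublists_nil (T : Type) (F : seq T -> nat) : sum_sublists F [::] = F [::].
Proof.
rewrite /sum_sublists (bigD1 [tuple]) //= big1 ?addn0 // => b.
by case/eqP; rewrite tuple0.
Qed.

(** The first bit of the mask tells whether [y] is selected; this is the deletion-contraction split
    of the sum. *)
Lemma sum_sublists_cons (T : Type) (F : seq T -> nat) y X :
  sum_sublists F (y :: X) =
  (sum_sublists F X + sum_sublists (fun A => F (y :: A)) X)%N.
Proof.
pose h (p : bool * (size X).-tuple bool) :
    (size (y :: X)).-tuple bool := [tuple of p.1 :: p.2].
rewrite /sum_sublists (reindex h) /=; last first.
  exists (fun b => (thead b, [tuple of behead b])) => [[a b]|b] _.
    by congr (_, _); apply/val_inj.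
  by rewrite [RHS]tuple_eta; apply/val_inj.
rewrite -(pair_bigA _ (fun a b => F (mask (h (a, b)) (y :: X)))) /=.
by rewrite big_bool addnC.
Qed.

Lemma sum_sublists_map (T U : Type) (h : T -> U) (F : seq U -> nat) X :
  sum_sublists F (map h X) = sum_sublists (fun A => F (map h A)) X.
Proof.
elim: X F => [|y X IH] F; first by rewrite !sum_sublists_nil.
by rewrite !sum_sublists_cons !IH.
Qed.

Lemma eq_sum_sublists (T : Type) (F G : seq T -> nat) X :
  (forall A, F A = G A) -> sum_sublists F X = sum_sublists G X.
Proof. by move=> FG; apply: eq_bigr => b _. Qed.

Lemma sum_sublistsMr (T : Type) (F : seq T -> nat) c X :
  sum_sublists (fun A => F A * c)%N X = (sum_sublists F X * c)%N.
Proof. by rewrite /sum_sublists big_distrl. Qed.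

(** * Dilated zonotopes and real spans *)

Section Zonotope.
Variable R : realType.

(** The dilate of the zonotope by [q], with the factor moved into the bound on the coefficients and
    one coefficient peeled off at a time, as the induction on the list requires. *)
Fixpoint zon n (q : R) (X : seq 'rV[int]_n) (v : 'rV[R]_n) : Prop :=
  if X is x :: X' then exists2 t, 0 <= t <= q & zon q X' (v - t *: toR R x)
  else v = 0.

Lemma zonP n q (X : seq 'rV[int]_n) v :
  zon q X v <-> exists t : 'I_(size X) -> R,
    (forall i, 0 <= t i <= q) /\ v = \sum_(i < size X) t i *: toR R X`_i.
Proof.
elim: X v => [|x X IH] v /=.
  split=> [->|[t [_]]]; last by rewrite big_ord0.
  by exists (fun=> 0); split=> [[]//|]; rewrite big_ord0.
split=> [[t0 t0q /IH [t [tq vE]]]|[t [tq ->]]].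
  exists (fun i => if unlift ord0 i is Some j then t j else t0); split.
    by move=> i; case: unliftP.
  rewrite big_ord_recl unlift_none /=.
  under eq_bigr => i _ do rewrite liftK.
  by rewrite -vE addrC subrK.
exists (t ord0) => //; apply/IH; exists (fun i => t (lift ord0 i)); split=> //.
by rewrite big_ord_recl addrAC subrr add0r.
Qed.

Lemma zon_convex n q (X : seq 'rV[int]_n) v w s :
  0 <= s <= 1 -> zon q X v -> zon q X w -> zon q X (s *: v + (1 - s) *: w).
Proof.
move=> s01; elim: X v w => [|x X IH] v w /=.
  by move=> -> ->; rewrite !scaler0 addr0.
move=> [t tq vX] [u uq wX]; exists (s * t + (1 - s) * u); first by nra.
rewrite (scalerDl (toR R x)) -!scalerA opprD addrACA -!scalerBr; exact: IH.
Qed.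

(** Each vector [x] of the list raises the bound on the linear form [f] by at most [q] times the
    absolute value of [f] at [x]. *)
Lemma zon_bounded n q (X : seq 'rV[int]_n) (f : 'cV[R]_n) : 0 <= q ->
  exists C, forall v, zon q X v -> `|(v *m f) 0 0| <= C.
Proof.
move=> q0; elim: X => [|x X [C IH]] /=.
  by exists 0 => v ->; rewrite mul0mx mxE normr0.
exists (C + q * `|(toR R x *m f) 0 0|) => v [t tq /IH].
rewrite mulmxBl -scalemxAl mxE [X in _ + X]mxE [X in - X]mxE.
set a := (v *m f) 0 0; set b := (toR R x *m f) 0 0 => le.
have -> : a = (a - t * b) + t * b by ring.
apply: (le_trans (ler_normD _ _)); apply: lerD => //.
rewrite normrM; have /andP[t0 tq'] := tq; rewrite (ger0_norm t0).
by apply: ler_wpM2r.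
Qed.

Lemma toRM n m (v : 'rV[int]_n) (M : 'M[int]_(n, m)) :
  toR R (v *m M) = toR R v *m map_mx intr M.
Proof. exact: map_mxM. Qed.

Lemma zon_map n m q (X : seq 'rV[int]_n) (M : 'M[int]_(n, m)) w :
  zon q (map (mulmx^~ M) X) w <->
  exists2 v, zon q X v & w = v *m map_mx intr M.
Proof.
elim: X w => [|x X IH] w /=.
  split=> [->|[v -> ->]]; last by rewrite mul0mx.
  by exists 0; rewrite ?mul0mx.
split=> [[t tq /IH [v vX wE]]|[v [t tq vX] ->]].
  exists (v + t *: toR R x); first by exists t; rewrite ?addrK.
  by rewrite mulmxDl -wE -scalemxAl -toRM subrK.
exists t => //; apply/IH; exists (v - t *: toR R x) => //.
by rewrite mulmxBl -scalemxAl -toRM.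
Qed.

Lemma zon_cons0 n q (X : seq 'rV[int]_n) v : 0 <= q ->
  zon q (0 :: X) v <-> zon q X v.
Proof.
move=> q0; split=> [[t _]|vX]; rewrite /= /toR ?map_mx0 ?scaler0 ?subr0 //.
by exists 0; rewrite ?lexx ?scale0r ?subr0.
Qed.

Lemma int_span_real n A v : int_span (n := n) A v -> toR R v \in real_span R A.
Proof.
elim: A v => [|y A IH] v.
  by move=> /int_span_nil ->; rewrite /toR map_mx0 mem0v.
move=> /int_span_cons [k [u [/IH Au ->]]].
rewrite /toR map_mxD map_mxZ /real_span /= span_cons memv_add // memvZ //.
exact: memv_line.
Qed.

Lemma toR_eq0 k (v : 'rV[int]_k) : (toR R v == 0) = (v == 0).
Proof.
apply/eqP/eqP => [/rowP v0|->]; last by rewrite /toR map_mx0.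
by apply/rowP => i; apply/eqP; have /eqP := v0 i; rewrite !mxE intr_eq0.
Qed.

Lemma real_span_cons k (y : 'rV[int]_k) A :
  real_span R (y :: A) = (<[toR R y]> + real_span R A)%VS.
Proof. exact: span_cons. Qed.

Definition real_hom n m (M : 'M[int]_(n, m)) : 'Hom('rV[R]_n, 'rV[R]_m) :=
  linfun (mulmxr (map_mx intr M)).

(** * Lattice points on the lines parallel to a vector *)

Section Contraction.
Variables (n m : nat) (e : 'rV[int]_n) (f : 'cV[int]_n).
Variables (S : 'M[int]_(m, n)) (M : 'M[int]_(n, m)) (g : nat).
Hypotheses (g_gt0 : (0 < g)%N) (split_e : splitting e f S M).

Notation pi := (mulmx^~ M).
Notation x := (e *+ g).

Lemma toRxE : toR R x = g%:R *: toR R e.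
Proof. by rewrite /toR raddfMn /= scaler_nat. Qed.

Lemma pi_fibre w k : pi (w *m S + k *: e) = w.
Proof.
have [_ eM SM _] := split_e.
by rewrite mulmxDl -scalemxAl eM scaler0 addr0 -mulmxA SM mulmx1.
Qed.

Lemma fibre_inj w k w' k' :
  w *m S + k *: e = w' *m S + k' *: e -> w = w' /\ k = k'.
Proof.
move=> eq1; have eqw : w = w' by rewrite -(pi_fibre w k) eq1 pi_fibre.
split=> //; move: eq1; rewrite eqw => /addrI /(congr1 (mulmx^~ f)).
have [ef _ _ _] := split_e.
by rewrite -!scalemxAl ef => /matrixP /(_ 0 0); rewrite !mxE !mulr1.
Qed.

Lemma toR_fibre w k : toR R (w *m S + k *: e) = toR R (w *m S) + k%:~R *: toR R e.
Proof. by rewrite /toR map_mxD map_mxZ. Qed.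

(** The section over a lattice point [w] may contain no lattice point, so [s] is real: it is the
    [e]-coordinate of any preimage of [w] in the zonotope. *)
Lemma zon_fibre_nonempty q X w :
  zon q (map pi X) (toR R w) -> exists s, zon q X (toR R (w *m S) + s *: toR R e).
Proof.
move=> /zon_map [v vX wE]; exists ((v *m map_mx intr f) 0 0).
by rewrite toRM wE -(splittingE (splitting_map _ split_e)).
Qed.

Lemma zon_fibre_convex q X p s1 s2 s :
  zon q X (p + s1 *: toR R e) -> zon q X (p + s2 *: toR R e) ->
  s1 <= s <= s2 -> zon q X (p + s *: toR R e).
Proof.
(* The case [s = s1] is settled first, so that the barycentric coordinate [c] has a positive
   denominator. *)
move=> X1 X2 /andP[]; rewrite le_eqVlt => /orP[/eqP <- //|lt1 le2].
have nz : 0 < s2 - s1 by lra.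
pose c := (s2 - s) / (s2 - s1).
have -> : p + s *: toR R e = c *: (p + s1 *: toR R e) + (1 - c) *: (p + s2 *: toR R e).
  rewrite !scalerDr addrACA -scalerDl !scalerA -scalerDl.
  congr (_ + _ *: _); first by rewrite addrC subrK scale1r.
  by rewrite /c; field; rewrite gt_eqF.
apply: zon_convex => //; rewrite /c ler_pdivlMr // mul0r ler_pdivrMr // mul1r.
by apply/andP; split; lra.
Qed.

(* On a line parallel to [x], appending [x] lengthens the segment cut out by the
   zonotope by [q * g] lattice steps; the new lattice points are those above the
   old segment whose translate by [- q * g] is not. *)
Lemma zon_fibre_diff (q : nat) X w :
  zon q%:R (map pi X) (toR R w) ->
  exists j0 : int, forall k : int,
    (zon q%:R (x :: X) (toR R (w *m S + k *: e)) /\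
     ~ zon q%:R X (toR R (w *m S + k *: e))) <->
    exists2 i, (i < q * g)%N & k = j0 + i%:Z.
Proof.
move=> /zon_fibre_nonempty; set p := toR R _ => -[s0 Xs0].
(* The integers strictly above the old segment; quantifying over all its points avoids naming its
   upper end. *)
pose U (k : int) := forall s, zon q%:R X (p + s *: toR R e) -> s < k%:~R.
have [C boundC] := @zon_bounded n q%:R X (map_mx intr f) (ler0n _ _).
have [ef _ _ _] := splitting_map R split_e.
(* As [f] takes the value 1 at [e], it reads off the parameter [s] up to a constant. *)
have {}boundC s : zon q%:R X (p + s *: toR R e) -> s <= C - (p *m map_mx intr f) 0 0.
  move=> /boundC; rewrite mulmxDl -scalemxAl ef mxE [X in _ + X]mxE [1%:M _ _]mxE mulr1.
  by move=> le; have := le_trans (ler_norm _) le; lra.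
have [j0 j0P] : exists j0 : int, forall j,
    (U j /\ ~ U (j - (q * g)%N%:Z)) <-> exists2 i, (i < q * g)%N & j = j0 + i%:Z.
  apply: upset_diff.
  - by move=> a b ab Ua s /Ua /lt_le_trans; apply; rewrite ler_int.
  - exists (Num.bound `|C - (p *m map_mx intr f) 0 0|)%:Z => s /boundC le.
    apply: le_lt_trans le _; rewrite -pmulrn; apply: le_lt_trans (archi_boundP _).
      exact: ler_norm.
    exact: normr_ge0.
  - exists (- (Num.bound `|s0|)%:Z) => /(_ _ Xs0); apply/negP; rewrite -leNgt.
    rewrite mulrNz -pmulrn lerNl; apply: ltW; apply: le_lt_trans (archi_boundP _).
      by rewrite -normrN; exact: ler_norm.
    exact: normr_ge0.
exists j0 => k; rewrite -j0P toR_fibre -/p.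
have g0 : 0 < g%:R :> R by rewrite ltr0n.
have lineE t : p + k%:~R *: toR R e - t *: toR R x = p + (k%:~R - t * g%:R) *: toR R e.
  by rewrite toRxE scalerA scalerBl addrA.
have shiftE : (k - (q * g)%N%:Z)%:~R = k%:~R - q%:R * g%:R :> R.
  by rewrite rmorphB /= -pmulrn natrM.
split=> [[/= [t tq]]|[Uk /existsNP [s /not_implyP [Xs /negP]]]].
  rewrite lineE => Xt nXk; split=> [s Xs|].
    (* The old segment contains [k - t * g], so if it also reached some [s] above or at [k], it
       would contain [k] by convexity. *)
    rewrite ltNge; apply/negP => les; apply: nXk; apply: zon_fibre_convex Xt Xs _.
    by rewrite les andbT; nra.
  by move=> /(_ _ Xt); rewrite shiftE; nra.
rewrite -leNgt shiftE => les; have lts := Uk _ Xs; split; last first.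
  by move=> /Uk; rewrite ltxx.
(* The coefficient of [x] that brings [k] back to [s]; it is at most [q] because [s] is at least
   [k - q * g]. *)
exists ((k%:~R - s) / g%:R).
  by rewrite ler_pdivlMr // mul0r ler_pdivrMr //; apply/andP; split; lra.
by rewrite lineE divfK ?gt_eqF // opprB subrKC.
Qed.

Lemma pi_x : pi x = 0.
Proof. by have [_ eM _ _] := split_e; rewrite -scaler_nat -scalemxAl eM scaler0. Qed.

Lemma zon_cons_size (q : nat) X N N' :
  has_size (fun v => zon q%:R X (toR R v)) N ->
  has_size (fun w => zon q%:R (map pi X) (toR R w)) N' ->
  has_size (fun v => zon q%:R (x :: X) (toR R v)) (N + N' * (q * g)).
Proof.
move=> [s [us ss sP]] [s' [us' ss' s'P]].
(* One starting point per line; for [w] outside the projected zonotope the value 0 is arbitrary. *)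
have /choice [j0 j0P] : forall w : 'rV[int]_m, exists j0 : int,
    zon q%:R (map pi X) (toR R w) -> forall k : int,
    (zon q%:R (x :: X) (toR R (w *m S + k *: e)) /\
     ~ zon q%:R X (toR R (w *m S + k *: e))) <->
    exists2 i, (i < q * g)%N & k = j0 + i%:Z.
  move=> w; have [Zw|nZw] := pselect (zon q%:R (map pi X) (toR R w)).
    by have [j0 j0P] := zon_fibre_diff Zw; exists j0.
  by exists 0.
pose F w i := w *m S + (j0 w + i%:Z) *: e.
exists (s ++ [seq F w i | w <- s', i <- iota 0 (q * g)]).
have Fs w i : w \in s' -> (i < q * g)%N ->
    zon q%:R (x :: X) (toR R (F w i)) /\ ~ zon q%:R X (toR R (F w i)).
  by move=> /s'P Zw ltiN; apply/(j0P w Zw); exists i.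
split.
- rewrite cat_uniq us /= andbC allpairs_uniq ?iota_uniq //=.
    apply/hasPn => _ /allpairsP [[w i] /= [w_s' + ->]].
    rewrite mem_iota /= => ltiN; apply/negP => /sP.
    by case: (Fs w i).
  move=> [w i] [w' i'] _ _ /= /fibre_inj [<- /addrI].
  by move=> [->].
- by rewrite size_cat size_allpairs size_iota ss ss'.
move=> v; rewrite mem_cat; split=> [/orP[/sP Xv|/allpairsP [[w i] /= [w_s' + ->]]]|xXv].
- by exists 0; rewrite ?lexx ?ler0n // scale0r subr0.
- by rewrite mem_iota => /(Fs _ _ w_s') [].
have [Xv|nXv] := pselect (zon q%:R X (toR R v)); first by apply/orP; left; apply/sP.
apply/orP; right.
(* Since [pi] kills [x], the enlarged zonotope has the same projection as the old one. *)
have Zw : zon q%:R (map pi X) (toR R (v *m M)).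
  have [t tq Xt] := xXv; apply/zon_map; exists (toR R v - t *: toR R x) => //.
  by rewrite mulmxBl -scalemxAl -!toRM pi_x /toR map_mx0 scaler0 subr0.
have vE := splittingE split_e v.
have [i ltiN kE] : exists2 i, (i < q * g)%N & (v *m f) 0 0 = j0 (v *m M) + i%:Z.
  by apply/(j0P _ Zw); rewrite -vE.
apply/allpairsP; exists (v *m M, i); split; rewrite ?mem_iota //=.
  by apply/s'P.
by rewrite /F -kE.
Qed.

(** * Rank and index under contraction *)

Notation piR := (real_hom M).

Lemma piRE v : piR v = v *m map_mx intr M.
Proof. by rewrite /real_hom lfunE. Qed.

Lemma limg_real_span A : (piR @: real_span R A)%VS = real_span R (map pi A).
Proof.
rewrite /real_span limg_span -!map_comp; congr (<<_>>)%VS.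
by apply: eq_map => v /=; rewrite piRE toRM.
Qed.

Lemma lker_pi : lker piR = <[toR R x]>%VS.
Proof.
have splitR := splitting_map R split_e.
have [_ eM _ _] := splitR.
have g0 : g%:R != 0 :> R by rewrite pnatr_eq0 -lt0n.
apply/vspaceP => v; rewrite memv_ker piRE; apply/eqP/vlineP => [v0|[c ->]].
  exists ((v *m map_mx intr f) 0 0 / g%:R).
  by rewrite {1}(splittingE splitR v) v0 mul0mx add0r toRxE scalerA divfK.
by rewrite toRxE -!scalemxAl eM !scaler0.
Qed.

Lemma limg_real_span_cons A :
  (piR @: real_span R (x :: A))%VS = real_span R (map pi A).
Proof.
rewrite limg_real_span /= pi_x real_span_cons /toR map_mx0.
by apply/addv_idPr; rewrite -memvE mem0v.
Qed.

Lemma e_neq0 : e != 0.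
Proof.
have [ef _ _ _] := split_e; apply/eqP => e0.
by move: ef; rewrite e0 mul0mx => /matrixP /(_ 0 0); rewrite !mxE.
Qed.

Lemma x_neq0 : x != 0.
Proof. by rewrite -scaler_nat scalemx_eq0 negb_or e_neq0 pnatr_eq0 -lt0n g_gt0. Qed.

(** Rank-nullity for the projection restricted to the span of [x :: A], which contains the whole
    kernel, the line of [x]. *)
Lemma rk_contract A : rk R (x :: A) = (rk R (map pi A)).+1.
Proof.
rewrite /rk -(limg_ker_dim piR) limg_real_span_cons lker_pi.
have /capv_idPr -> : (<[toR R x]> <= real_span R (x :: A))%VS.
  by rewrite real_span_cons addvSl.
by rewrite dim_vline toR_eq0 x_neq0.
Qed.

(** If the span of [A] met the kernel line in a nonzero vector, it would contain [x], and the rank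
    of [x :: A] would be at most [size A]. *)
Lemma rk_free_meet A v : rk R (x :: A) = (size A).+1 ->
  toR R v \in real_span R A -> pi v = 0 -> v = 0.
Proof.
move=> rkxA vA piv0; apply/eqP; rewrite -(toR_eq0 v); apply: contra_eqT rkxA => nzv.
have : toR R v \in lker piR by rewrite memv_ker piRE -toRM piv0 /toR map_mx0.
rewrite lker_pi => /vlineP [c vE].
have nzc : c != 0 by apply: contraNneq nzv => c0; rewrite vE c0 scale0r.
have xA : toR R x \in real_span R A.
  by rewrite -[toR R x](scalerK nzc) -vE memvZ.
rewrite /rk real_span_cons; have /addv_idPr -> : (<[toR R x]> <= real_span R A)%VS.
  by rewrite -memvE.
have := dim_span (map (@toR R n) A); rewrite size_map => le.
by rewrite neq_ltn ltnS le.
Qed.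

(** Each representative [w] downstairs has [g] lifts [w *m S + i *: e] with [i < g], because the
    span of [x :: A] contains [g] times [e]. Independence keeps these lifts in distinct cosets. *)
Lemma index_contract A N : rk R (x :: A) = (size A).+1 ->
  is_index (saturation R (map pi A)) (int_span (map pi A)) N ->
  is_index (saturation R (x :: A)) (int_span (x :: A)) (N * g).
Proof.
move=> rkxA [s [us ss sH Hs sK]].
pose F w i := w *m S + (Posz i) *: e.
have piF w i : pi (F w i) = w by rewrite /F pi_fibre.
have g_neq0 : g%:Z != 0 by rewrite -lt0n.
exists [seq F w i | w <- s, i <- iota 0 g]; split.
- rewrite allpairs_uniq ?iota_uniq // => -[w i] [w' i'] _ _ /=.
  by move=> /fibre_inj [<- [<-]].
- by rewrite size_allpairs size_iota ss.
- move=> _ /allpairsP [[w i] /= [/sH ws _ ->]].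
  (* A real preimage [u] of [w] in the span differs from [F w i] by a multiple of [x], which is also
     in the span. *)
  have : toR R w \in (piR @: real_span R (x :: A))%VS by rewrite limg_real_span_cons.
  move=> /memv_imgP [u uA wE].
  rewrite /saturation /= -[toR R _](subrK u) memvD //.
  have : toR R (F w i) - u \in lker piR.
    by rewrite memv_ker linearB /= -wE piRE -toRM piF subrr.
  rewrite lker_pi; apply: subvP; by rewrite real_span_cons addvSl.
- move=> v vxA; have /Hs [w ws] : saturation R (map pi A) (pi v).
    by rewrite /saturation /= -limg_real_span_cons toRM -piRE memv_img.
  move=> /int_span_map [u uA uE].
  (* The vector [v - u - w *m S] projects to 0, hence equals [k *: e]; dividing [k] by [g] leaves
     the index of the lift as remainder and a multiple of [x] as quotient. *)
  pose k := ((v - u - w *m S) *m f) 0 0.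
  have vE : v = F w `|(k %% g)%Z|%N + ((k %/ g)%Z *: x + u).
    have [_ _ SM _] := split_e.
    have zM : (v - u - w *m S) *m M = 0.
      by rewrite !mulmxBl -mulmxA SM mulmx1 -uE opprB subrKC subrr.
    have kE : v - u - w *m S = ((k %/ g)%Z * g%:Z) *: e + (k %% g)%Z *: e.
      by rewrite -scalerDl -divz_eq {1}[LHS](splittingE split_e) zM mul0mx add0r.
    rewrite /F gez0_abs ?modz_ge0 // -scaler_nat scalerA natz.
    rewrite -[LHS](subrK u) -[X in X + u = _](subrK (w *m S)) kE [RHS]addrA.
    by congr (_ + u); rewrite -[RHS]addrA [LHS]addrC; congr (_ + _); exact: addrC.
  exists (F w `|(k %% g)%Z|%N).
    apply/allpairsP; exists (w, `|(k %% g)%Z|%N); split=> //.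
    by rewrite mem_iota /= add0n -ltz_nat gez0_abs ?modz_ge0 // ltz_pmod.
  by rewrite {1}vE addrC addKr; apply/int_span_cons; exists (k %/ g)%Z, u.
move=> _ _ /allpairsP [[w i] /= [ws + ->]] /allpairsP [[w' i'] /= [ws' + ->]].
rewrite !mem_iota /= !add0n => lti lti' /int_span_cons [k [u [uA FE]]].
have eqw : w = w'.
  apply: sK => //; apply/int_span_map; exists u => //.
  by rewrite -(piF w i) -(piF w' i') -mulmxBl FE mulmxDl -scalemxAl pi_x scaler0 add0r.
rewrite -eqw {w' eqw ws'} in FE *.
(* Once [u] vanishes, the two lifts differ by a multiple of [x], so [i] and [i'] agree modulo
   [g]. *)
have u0 : u = 0.
  apply: (rk_free_meet rkxA); first exact: int_span_real.
  have := congr1 (mulmx^~ M) FE; rewrite mulmxBl !piF subrr mulmxDl -scalemxAl pi_x.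
  by rewrite scaler0 add0r => <-.
congr F; apply/eqP; rewrite -(modn_small lti) -(modn_small lti') -eqz_nat -!modz_nat.
rewrite eqz_mod_dvd; apply/dvdzP; exists k.
have := congr1 (mulmx^~ f) FE; have [ef _ _ _] := split_e.
rewrite u0 addr0 /F opprD addrACA subrr add0r -scalerBl -scaler_nat scalerA natz.
by rewrite -!scalemxAl ef => /matrixP /(_ 0 0); rewrite !mxE !mulr1.
Qed.

End Contraction.

(** * Independent sublists and the lattice point count *)

Lemma rk_le_size n (A : seq 'rV[int]_n) : (rk R A <= size A)%N.
Proof. by rewrite /rk /real_span (leq_trans (dim_span _)) ?size_map. Qed.

Lemma rk_cons0 n (A : seq 'rV[int]_n) : rk R (0 :: A) = rk R A.
Proof.
rewrite /rk real_span_cons; congr (\dim _); apply/addv_idPr.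
by rewrite -memvE /toR map_mx0 mem0v.
Qed.

Lemma rk_nil n : rk R (n := n) [::] = 0%N.
Proof. by rewrite /rk /real_span span_nil dimv0. Qed.

Lemma multiplicityE n (A : seq 'rV[int]_n) N :
  is_index (saturation R A) (int_span A) N -> multiplicity R A = N.
Proof. by apply: is_index_group_index; [exact: int_span0 | exact: int_spanB]. Qed.

Lemma index_nil n : is_index (saturation R (n := n) [::]) (int_span [::]) 1.
Proof.
exists [:: 0]; split=> // [v|v|v w].
- by rewrite inE => /eqP ->; rewrite /saturation /= /toR map_mx0 mem0v.
- rewrite /saturation /= /real_span span_nil memv0 toR_eq0 => /eqP ->.
  by exists 0; rewrite ?inE ?subrr //; exact: int_span0.
- by rewrite !inE => /eqP -> /eqP ->.
Qed.

(** The point is that the index is finite, so that [multiplicity] is not the default value of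
    [ncard]. The first vector of an independent list is nonzero and can be contracted, by induction
    on the length. *)
Lemma index_free n (A : seq 'rV[int]_n) : rk R A = size A ->
  is_index (saturation R A) (int_span A) (multiplicity R A).
Proof.
have [k] := ubnP (size A); elim: k => // k IH in n A *; case: A => [_ _|x A /= sA rkA].
  by rewrite (multiplicityE (@index_nil n)); exact: index_nil.
have [x0|/primitive_splitting] := eqVneq x 0.
  by have := rk_le_size A; rewrite -rk_cons0 -x0 rkA ltnn.
move=> [m [e [f [S [M [g [g_gt0 xE split_e]]]]]]]; rewrite {}xE in rkA *.
have /IH idx : (size (map (mulmx^~ M) A) < k)%N by rewrite size_map.
have /idx /(index_contract g_gt0 split_e rkA) idx' :
    rk R (map (mulmx^~ M) A) = size (map (mulmx^~ M) A).
  by rewrite size_map; move: rkA; rewrite (rk_contract g_gt0 split_e) => -[].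
by rewrite (multiplicityE idx').
Qed.

(** The term of [A] in $q^n M_X(1+1/q,1)$: the power of $y-1$ kills dependent sublists, and for the
    others $q^n (1/q)^{n-|A|} = q^{|A|}$. *)
Definition free_weight (q : nat) n (A : seq 'rV[int]_n) : nat :=
  if rk R A == size A then (multiplicity R A * q ^ size A)%N else 0%N.

(** Contraction preserves independence in both directions; the factor [g] comes from the index and
    the factor [q] from the lost vector. *)
Lemma free_weight_contract q n m e f (S : 'M[int]_(m, n)) M g A :
  (0 < g)%N -> splitting e f S M ->
  free_weight q (e *+ g :: A) = (free_weight q (map (mulmx^~ M) A) * (q * g))%N.
Proof.
move=> g_gt0 split_e; rewrite /free_weight (rk_contract g_gt0 split_e) size_map /=.
rewrite eqSS; case: eqP => [rkA|_]; last by rewrite mul0n.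
have rkxA : rk R (e *+ g :: A) = (size A).+1.
  by rewrite (rk_contract g_gt0 split_e) rkA.
have := @index_free _ (map (mulmx^~ M) A); rewrite size_map => /(_ rkA).
move=> /(index_contract g_gt0 split_e rkxA) /multiplicityE ->.
by rewrite expnS; ring.
Qed.

Lemma zon_size q n (X : seq 'rV[int]_n) :
  has_size (fun v => zon q%:R X (toR R v)) (sum_sublists (@free_weight q n) X).
Proof.
(* Induction on the length, since the contracted list is not a tail of [X] and lives in another
   dimension. *)
have [k] := ubnP (size X); elim: k => // k IH in n X *; case: X => [_|x X /= sX].
  rewrite sum_sublists_nil /free_weight rk_nil eqxx (multiplicityE (@index_nil n)).
  exists [:: 0]; split=> // v; rewrite inE /= -toR_eq0.
  by split=> /eqP.
rewrite sum_sublists_cons.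
have [->|/primitive_splitting] := eqVneq x 0.
  (* A zero vector does not change the zonotope, and no sublist selecting it is independent. *)
  apply: (@eq_has_size _ (fun v => zon q%:R X (toR R v))).
    by move=> v; symmetry; apply: zon_cons0.
  rewrite [X in (_ + X)%N]big1 ?addn0; first exact: IH.
  move=> b _; rewrite /free_weight rk_cons0 ifN //.
  by rewrite neq_ltn ltnS rk_le_size.
move=> [m [e [f [S [M [g [g_gt0 -> split_e]]]]]]].
rewrite (eq_sum_sublists _ (fun A => free_weight_contract q A g_gt0 split_e)).
rewrite sum_sublistsMr -sum_sublists_map.
apply: (zon_cons_size g_gt0 split_e); apply: IH => //.
by rewrite size_map.
Qed.

(** * From the count to the Ehrhart function and the Tutte polynomial *)

Lemma dilate_zonotope q n (X : seq 'rV[int]_n) v : 0 < q ->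
  zon q X v <-> dilate q (zonotope (R := R) X) v.
Proof.
move=> q0; split=> [/zonP [t [tq ->]]|[_ [t [t1 ->]] <-]].
  exists (q^-1 *: \sum_(i < size X) t i *: toR R X`_i).
    exists (fun i => q^-1 * t i); split=> [i|].
      have /andP[t0 tle] := tq i.
      apply/andP; split; first by rewrite mulr_ge0 // invr_ge0 ltW.
      by rewrite mulrC ler_pdivrMr // mul1r.
    by rewrite scaler_sumr; apply: eq_bigr => i _; rewrite scalerA.
  by rewrite scalerA divff ?gt_eqF // scale1r.
apply/zonP; exists (fun i => q * t i); split=> [i|].
  have /andP[t0 tle] := t1 i.
  by apply/andP; split; [rewrite mulr_ge0 // ltW|rewrite ger_pMr].
by rewrite scaler_sumr; apply: eq_bigr => i _; rewrite scalerA.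
Qed.

Lemma ehrhart_sum n (X : seq 'rV[int]_n) q : (0 < q)%N ->
  ehrhart R X q = sum_sublists (@free_weight q n) X.
Proof.
move=> q0; apply: has_size_ncard; apply: eq_has_size (zon_size q X) => v.
by apply: dilate_zonotope; rewrite ltr0n.
Qed.

Lemma rk_le_dim n (A : seq 'rV[int]_n) : (rk R A <= n)%N.
Proof. by rewrite /rk (leq_trans (dimvS (subvf _))) // dimvf /dim /= mul1n. Qed.

End Zonotope.

Theorem theorem3p2 (R : realType) (n : nat) (X : seq 'rV[int]_n)
    (spanX : real_span R X = fullv) (q : nat) (q_gt0 : (0 < q)%N) :
  (ehrhart R X q)%:R = q%:R ^+ n * (mult_tutte R X).[1 + 1 / q%:R, 1] :> R.
Proof.
rewrite ehrhart_sum // /sum_sublists natr_sum /mult_tutte.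
rewrite !horner_sum mulr_sumr; apply: eq_bigr => b _ /=.
set A := mask b X.
have q0 : q%:R != 0 :> R by rewrite pnatr_eq0 -lt0n.
(* At [y = 1] the last factor is a power of 0, equal to 1 exactly when the truncated difference is
   0, that is when [size A] is at most the rank. *)
have -> : ((multiplicity R A)%:R * ('X - 1) ^+ (n - rk R A) *
    ('Y - 1) ^+ (size A - rk R A)).[1 + 1 / q%:R, 1] =
    (multiplicity R A)%:R * q%:R ^- (n - rk R A) * (rk R A == size A)%:R :> R.
  rewrite !hornerE -!polyC_natr !hornerC.
  rewrite [1 + _ - 1]addrAC subrr add0r expr0n subn_eq0 exprVn.
  by rewrite eqn_leq rk_le_size.
rewrite /free_weight; case: eqP => [rkA|_]; last by rewrite !mulr0.
rewrite mulr1 natrM natrX mulrCA; congr (_ * _).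
(* The bound of the rank by [n] makes [n - (n - rk R A)] equal to the rank despite truncation. *)
by rewrite -rkA -exprB ?leq_subr ?unitfE // subKn // rk_le_dim.
Qed.
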